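(* Let $G$ be a deterministic labeled graph with vertex set $Q$. Then $G$ is synchronizing if and only if for each initial irreducible component $C$ of $G$ there exist (i) a synchronizing word for the subgraph induced by $C$, and (ii) a word separating the subgraph induced by $C$ from the subgraph induced by $Q\setminus C$.
   Context: A labeled graph has a finite vertex set, finite edge set, initial/terminal vertex maps on edges and an edge labeling into a finite alphabet (loops and multiple edges allowed; not necessarily essential). Paths are finite sequences of consecutive edges with concatenated labels; each vertex has an empty path labeled $\epsilon$. $F_G(q)$ is the set of labels of paths starting at $q$. $G$ is deterministic if no vertex has two outgoing edges with the same label; then $q\cdot w$ is the end vertex of the unique path from $q$ labeled $w$ (defined iff $w\in F_G(q)$), and $S\cdot w=\{q\cdot w:q\in S,\ w\in F_G(q)\}$. A word $w$ is synchronizing for $G$ if $Q_G\cdot w=\{r\}$ for a single vertex $r$ (it synchronizes to $r$); $G$ is synchronizing if every vertex $r$ has a word synchronizing to $r$. The subgraph induced by $P\subseteq Q$ has vertex set $P$ and all edges of $G$ with both endpoints in $P$, with the same labels. Irreducible components are the classes of the relation ''$p$ and $q$ are reachable from each other by paths''; a component $C$ is initial if whenever $q\in C$ is reachable from $p$, then $p\in C$. A word $w$ separates $G_1$ from $G_2$ if $Q_{G_1}\cdot w\neq\varnothing$ and $Q_{G_2}\cdot w=\varnothing$. *)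

(* Defs.v *)
From mathcomp Require Import all_boot.

Set Implicit Arguments.
Unset Strict Implicit.
Unset Printing Implicit Defensive.

Record lgraph (A : finType) := LGraph {
  vertex : finType;
  edge : finType;
  src : edge -> vertex;
  tgt : edge -> vertex;
  lab : edge -> A
}.

Arguments src {A} l _.
Arguments tgt {A} l _.
Arguments lab {A} l _.

Section LabeledGraphs.

Variable A : finType.
Implicit Types (G : lgraph A) (w : seq A).

(* A path is given by its starting vertex and its sequence of edges, so that
   every vertex has its own empty path. *)
Fixpoint gpath G (q : vertex G) (p : seq (edge G)) : bool :=
  if p is e :: p' then (src G e == q) && gpath (tgt G e) p' else true.

Definition path_end G (q : vertex G) (p : seq (edge G)) : vertex G :=
  last q [seq tgt G e | e <- p].

Definition path_label G (p : seq (edge G)) : seq A := [seq lab G e | e <- p].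

(* A path labeled w has length size w, so quantifying over tuples is no
   restriction and makes the notion decidable. *)
Definition path_from G (q : vertex G) w (p : (size w).-tuple (edge G)) : bool :=
  gpath q p && (path_label p == w).

Definition follower G (q : vertex G) : pred (seq A) :=
  fun w => [exists p : (size w).-tuple (edge G), path_from q p].

Definition deterministic G : Prop :=
  forall e1 e2 : edge G,
    src G e1 = src G e2 -> lab G e1 = lab G e2 -> e1 = e2.

(* The partial map q . w, with None for "undefined"; in a deterministic graph
   the path that is picked is the only one (see dotP). *)
Definition dot G (q : vertex G) w : option (vertex G) :=
  omap (fun p : (size w).-tuple (edge G) => path_end q p)
       [pick p : (size w).-tuple (edge G) | path_from q p].

Definition dot_set G (S : {set vertex G}) w : {set vertex G} :=
  [set r | [exists q in S, dot q w == Some r]].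

Definition synchronizes_to G w (r : vertex G) : Prop :=
  dot_set [set: vertex G] w = [set r].

Definition synchronizing_word G w : Prop :=
  exists r : vertex G, synchronizes_to w r.

Definition synchronizing G : Prop :=
  forall r : vertex G, exists w, synchronizes_to w r.

Definition separates (G1 G2 : lgraph A) w : Prop :=
  dot_set [set: vertex G1] w <> set0 /\ dot_set [set: vertex G2] w = set0.

Section Induced.

Variables (G : lgraph A) (P : {set vertex G}).

Definition ind_vertex := {q : vertex G | q \in P}.
Definition ind_edge := {e : edge G | (src G e \in P) && (tgt G e \in P)}.

Definition ind_src (e : ind_edge) : ind_vertex :=
  exist _ (src G (val e)) (proj1 (andP (valP e))).
Definition ind_tgt (e : ind_edge) : ind_vertex :=
  exist _ (tgt G (val e)) (proj2 (andP (valP e))).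
Definition ind_lab (e : ind_edge) : A := lab G (val e).

Definition induced : lgraph A := LGraph ind_src ind_tgt ind_lab.

End Induced.

Definition reachable G (p q : vertex G) : Prop :=
  exists s : seq (edge G), gpath p s /\ path_end p s = q.

Definition irreducible_component G (C : {set vertex G}) : Prop :=
  exists q : vertex G,
    forall p : vertex G, p \in C <-> reachable p q /\ reachable q p.

Definition initial G (C : {set vertex G}) : Prop :=
  forall p q : vertex G, q \in C -> reachable p q -> p \in C.

Lemma follower_dot G (q : vertex G) w : (w \in follower q) = (dot q w != None).
Proof.
rewrite /dot unfold_in /follower; case: pickP => [p qp|noP] /=.
  by apply/existsP; exists p.
by apply/existsP => -[p]; rewrite noP.
Qed.

Lemma det_path_inj G (q : vertex G) (p1 p2 : seq (edge G)) :
  deterministic G -> gpath q p1 -> gpath q p2 ->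
  path_label p1 = path_label p2 -> p1 = p2.
Proof.
move=> detG; elim: p1 p2 q => [|e1 p1 IH] [|e2 p2] q //=.
move=> /andP[/eqP e1q qp1] /andP[/eqP e2q qp2] [lab12 labp].
have e12 : e1 = e2 by apply: detG; rewrite ?e1q.
by subst e2; rewrite (IH p2 (tgt G e1)).
Qed.

Lemma dotP G (q : vertex G) w (r : vertex G) : deterministic G ->
  dot q w = Some r <->
  exists p : seq (edge G), [/\ gpath q p, path_label p = w & path_end q p = r].
Proof.
move=> detG; rewrite /dot; split.
  by case: pickP => //= p /andP[qp /eqP pw] [<-]; exists p.
case=> p [qp pw pr]; case: pickP => /= [p' /andP[qp' /eqP p'w]|noP].
  by rewrite (det_path_inj detG qp' qp) ?p'w // pr.
have szp : size p == size w by rewrite -pw size_map.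
by have := noP (Tuple szp); rewrite /path_from /= qp pw eqxx.
Qed.

End LabeledGraphs.

(* Main.v *)
(** An initial component [C] is closed under predecessors, hence so is its
    complement under successors. If [w] synchronizes [G] to a vertex of [C],
    every path labeled [w] lies in [C], so [w] both synchronizes [C] and
    separates it from its complement. Conversely, let [u] synchronize [C] to [s],
    let [v] be separating, labeling a path from [p] to [p'] in [C], and let [y]
    label a path from [s] to [p]. A path of [G] labeled [u y v] cannot be
    outside [C] before reading [v], so it is at [s] after reading [u], and
    [u y v] synchronizes [G] to [p']. Every vertex is reachable from some
    initial component, and a synchronizing word can be prolonged along a path. *)
Require Import Defs.
From mathcomp Require Import all_boot.

Set Implicit Arguments.
Unset Strict Implicit.
Unset Printing Implicit Defensive.

(** Paths recast as a relation by recursion on the word: concatenation and passage to induced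
    subgraphs become inductions on [w], with no tuples or partial maps. *)
Fixpoint run (A : finType) (G : lgraph A) (q : vertex G) (w : seq A)
    (r : vertex G) : Prop :=
  if w is a :: w' then
    exists e : edge G, [/\ src G e = q, lab G e = a & run (tgt G e) w' r]
  else q = r.

Section Runs.

Variables (A : finType) (G : lgraph A).
Implicit Types (p q r : vertex G) (u v w : seq A).

Lemma runP q w r :
  run q w r <->
  exists s : seq (edge G), [/\ gpath q s, path_label s = w & path_end q s = r].
Proof.
elim: w q => [|a w IH] q /=; split.
- by move=> <-; exists [::].
- by case=> -[|e s] [].
- case=> e [<- <- /IH[s [es <- <-]]]; exists (e :: s).
  by rewrite /= eqxx es.
- case=> -[|e s] [] //= /andP[/eqP eq es] [<- sw] sr.
  by exists e; split=> //; apply/IH; exists s.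
Qed.

Lemma reachableP p q : reachable p q <-> exists w, run p w q.
Proof.
split; first by case=> s [ps sq]; exists (path_label s); apply/runP; exists s.
by case=> w /runP[s [ps _ sq]]; exists s.
Qed.

Lemma run_cat q u v r :
  run q (u ++ v) r <-> exists2 m, run q u m & run m v r.
Proof.
elim: u q => [|a u IH] q /=; split.
- by exists q.
- by case=> m ->.
- by case=> e [eq ea /IH[m um vm]]; exists m => //; exists e.
- case=> m [e [eq ea um]] vm; exists e; split=> //.
  by apply/IH; exists m.
Qed.

Lemma reachable_trans p q r : reachable p q -> reachable q r -> reachable p r.
Proof.
move=> /reachableP[u pq] /reachableP[v qr]; apply/reachableP.
by exists (u ++ v); apply/run_cat; exists q.
Qed.

Lemma reachable_refl p : reachable p p.
Proof. by exists [::]. Qed.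

(** A boolean one-step relation makes reachability decidable, so that sets of predecessors can be
    formed and counted. *)
Definition edge_rel : rel (vertex G) :=
  fun p q => [exists e, (src G e == p) && (tgt G e == q)].

Lemma reachable_connect p q : reachable p q <-> connect edge_rel p q.
Proof.
split.
  case=> s [ps <-]; apply/connectP; exists [seq tgt G e | e <- s] => //.
  elim: s p ps => //= e s IH p /andP[/eqP ep es]; rewrite IH // andbT.
  by apply/existsP; exists e; rewrite ep !eqxx.
case/connectP=> s; elim: s p => [|m s IH] p /= => [_ ->|].
  exact: reachable_refl.
case/andP=> /existsP[e /andP[/eqP ep /eqP em]] ms qs.
apply: reachable_trans (IH _ ms qs).
by exists [:: e]; rewrite /path_end /= ep em eqxx.
Qed.

(** Among the vertices that reach [r], take [s] with the fewest predecessors; its component is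
    initial. *)
Lemma reachable_from_initial r :
  exists (C : {set vertex G}) (s : vertex G),
    [/\ irreducible_component C, initial C, s \in C & reachable s r].
Proof.
pose before (s : vertex G) := [set p | connect edge_rel p s].
case: (@arg_minnP _ r (fun s => connect edge_rel s r) (fun s => #|before s|)
         (connect0 _ r)) => s sr min_s.
exists [set p | connect edge_rel p s && connect edge_rel s p], s.
split; last exact/reachable_connect.
- exists s => p; rewrite inE; split.
    by case/andP=> ps sp; split; apply/reachable_connect.
  by case=> /reachable_connect -> /reachable_connect ->.
- move=> p q; rewrite !inE => /andP[qs _] /reachable_connect pq.
  have ps := connect_trans pq qs; rewrite ps /=.
  (* Since [p] also reaches [r], minimality of [s] turns this inclusion into an equality, whence [s]
     reaches [p]. *)
  have sub : before p \subset before s.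
    by apply/subsetP=> t; rewrite !inE => /connect_trans; apply.
  have /eqP eq_ps : before p == before s.
    by rewrite eqEcard sub min_s // (connect_trans ps).
  have : s \in before s by rewrite inE connect0.
  by rewrite -eq_ps inE.
- by rewrite inE connect0.
Qed.

Hypothesis detG : deterministic G.

Lemma run_det q w r1 r2 : run q w r1 -> run q w r2 -> r1 = r2.
Proof.
elim: w q => [|a w IH] q /=; first by move=> <-.
case=> e1 [e1q e1a w1] [e2 [e2q e2a w2]].
have e12 : e1 = e2 by apply: detG; rewrite ?e1q ?e1a.
by apply: IH w1 _; rewrite e12.
Qed.

Lemma in_dot_setT w r :
  r \in dot_set [set: vertex G] w <-> exists q, run q w r.
Proof.
rewrite inE; split.
  by case/existsP=> q /andP[_ /eqP /(dotP _ _ _ detG) /runP]; exists q.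
case=> q /runP qr; apply/existsP; exists q; rewrite inE /=.
by apply/eqP/dotP.
Qed.

Lemma synchronizes_toP w r :
  synchronizes_to w r <->
  (exists q, run q w r) /\ forall q r', run q w r' -> r' = r.
Proof.
split=> [wr | [qr w_r]].
  split; first by apply/in_dot_setT; rewrite wr set11.
  move=> q r' qr'; apply/set1P; rewrite -wr.
  by apply/in_dot_setT; exists q.
apply/setP=> t; rewrite in_set1; apply/idP/eqP => [/in_dot_setT[q]|->].
  exact: w_r.
exact/in_dot_setT.
Qed.

Lemma synchronizes_to_cat w v r t :
  synchronizes_to w r -> run r v t -> synchronizes_to (w ++ v) t.
Proof.
move=> /synchronizes_toP[[q qr] w_r] rt; apply/synchronizes_toP; split.
  by exists q; apply/run_cat; exists r.
by move=> q' t' /run_cat[m /w_r ->] rt'; apply: run_det rt' rt.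
Qed.

Lemma dot_setT_eq0P w :
  dot_set [set: vertex G] w = set0 <-> forall q r, ~ run q w r.
Proof.
split=> [w0 q r qr | no_run].
  suff : r \in set0 by rewrite inE.
  by rewrite -w0; apply/in_dot_setT; exists q.
apply/setP=> r; rewrite in_set0; apply/negP => /in_dot_setT[q].
exact: no_run.
Qed.

End Runs.

Section InducedRuns.

Variables (A : finType) (G : lgraph A) (P : {set vertex G}).

Lemma induced_det : deterministic G -> deterministic (induced P).
Proof.
by move=> detG e1 e2 /= [src12] lab12; apply/val_inj/detG.
Qed.

Lemma run_val (q r : vertex (induced P)) w :
  run q w r -> run (val q) w (val r).
Proof.
elim: w q => [|a w IH] q /= => [-> //|].
by case=> e [<- <- /IH er]; exists (val e).
Qed.

(** Every vertex on the path lies between its two ends, so convexity of [P] keeps the path inside.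
    Convexity covers both an initial set and its complement. *)
Lemma run_induced (q r : vertex (induced P)) w :
  (forall x y z, x \in P -> z \in P -> reachable x y -> reachable y z ->
     y \in P) ->
  run (val q) w (val r) -> run q w r.
Proof.
move=> convexP; elim: w q => [|a w IH] q /=; first exact: val_inj.
case=> e [eq ea er].
have srcP : src G e \in P by rewrite eq (valP q).
have tgtP : tgt G e \in P.
  apply: convexP srcP (valP r) _ _; apply/reachableP; last by exists w.
  by exists [:: lab G e], e.
have eP : (src G e \in P) && (tgt G e \in P) by rewrite srcP.
exists (exist _ e eP); split=> //; first exact: val_inj.
exact: IH.
Qed.

End InducedRuns.

Section InitialSet.

Variables (A : finType) (G : lgraph A) (C : {set vertex G}).
Hypothesis initC : initial C.

Lemma initial_run q w r : run q w r -> r \in C -> q \in C.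
Proof. by move=> qr rC; apply: initC rC _; apply/reachableP; exists w. Qed.

Lemma run_induced_initial (q r : vertex (induced C)) w :
  run (val q) w (val r) -> run q w r.
Proof. by apply: run_induced => x y z _ zC _ yz; apply: initC zC yz. Qed.

Lemma run_induced_setC (q r : vertex (induced (~: C))) w :
  run (val q) w (val r) -> run q w r.
Proof.
apply: run_induced => x y z; rewrite !inE => xNC _ xy _.
by apply: contra xNC => yC; apply: initC yC xy.
Qed.

Hypothesis detG : deterministic G.

Lemma synchronizes_to_induced w (r : vertex (induced C)) :
  synchronizes_to w (val r) ->
  synchronizes_to w r /\ separates (induced C) (induced (~: C)) w.
Proof.
move=> /(synchronizes_toP detG)[[q qr] w_r].
have qC := initial_run qr (valP r).
have qr' : run (exist _ q qC : vertex (induced C)) w r.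
  exact: run_induced_initial.
split.
  apply/(synchronizes_toP (induced_det detG)); split; first by eexists; apply: qr'.
  by move=> t r' /run_val /w_r /val_inj.
split; first by move/(dot_setT_eq0P (induced_det detG)); apply; apply: qr'.
apply/(dot_setT_eq0P (induced_det detG)) => t t' /run_val /w_r t'r.
by have := valP t'; rewrite t'r inE (valP r).
Qed.

Lemma synchronizes_to_initial u y v (s p p' : vertex (induced C)) :
    synchronizes_to u s -> run (val s) y (val p) -> run p v p' ->
    dot_set [set: vertex (induced (~: C))] v = set0 ->
  synchronizes_to (u ++ y ++ v) (val p').
Proof.
move=> /(synchronizes_toP (induced_det detG))[[q qs] u_s] sp pp'.
move=> /(dot_setT_eq0P (induced_det detG)) v0.
have sp' : run (val s) (y ++ v) (val p').
  by apply/run_cat; exists (val p) => //; apply: run_val.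
apply/(synchronizes_toP detG); split.
  by exists (val q); apply/run_cat; exists (val s) => //; apply: run_val.
move=> t t' /run_cat[m tm mt'].
(* If the vertex [m] reached after [u] is in [C], then the whole run of [u] is in [C] and ends at
   [s]; determinism fixes the rest. *)
suff mC : m \in C.
  have tC := initial_run tm mC.
  have ms : exist _ m mC = s.
    by apply: (u_s (exist _ t tC)); apply: run_induced_initial.
  by apply: run_det mt' _ => //; rewrite -[m]/(val (exist _ m mC)) ms.
(* Were the vertex [n] before [v] outside [C], the run of [v] would stay outside, against the
   separation property. *)
have /run_cat[n mn nt'] := mt'.
apply: initial_run mn _; apply: contraT => nNC.
have nNC' : n \in ~: C by rewrite inE.
have t'NC : t' \in ~: C.
  by rewrite inE; apply: contra nNC; apply: initial_run nt'.
by case: (v0 (exist _ n nNC') (exist _ t' t'NC)); apply: run_induced_setC.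
Qed.

End InitialSet.

Theorem theorem3p3 (A : finType) (G : lgraph A) (detG : deterministic G) :
  synchronizing G <->
  (forall C : {set vertex G}, irreducible_component C -> initial C ->
     (exists w : seq A, synchronizing_word (induced C) w) /\
     (exists w : seq A, separates (induced C) (induced (~: C)) w)).
Proof.
split=> [syncG C [r compC] initC | compG r].
  have rC : r \in C by apply/compC; split; apply: reachable_refl.
  have [w wr] := syncG r.
  have [wC sepw] :=
    synchronizes_to_induced initC detG (r := exist _ r rC) wr.
  by split; exists w => //; exists (exist _ r rC).
have [C [c [compC initC cC cr]]] := reachable_from_initial r.
have [[u [s us]] [v [vC vNC]]] := compG C compC initC.
have /set0Pn[p' /(in_dot_setT (induced_det detG))[p pp']] := introN eqP vC.
have [c0 inC] := compC.
have linked (x z : vertex G) : x \in C -> z \in C -> reachable x z.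
  by move=> /inC[xc _] /inC[_ cz]; apply: reachable_trans xc cz.
have /reachableP[y sp] := linked _ _ (valP s) (valP p).
(* As [r] may lie outside [C], the final factor [z] goes from [p'] to [c] within the component, then
   on to [r]. *)
have /reachableP[z p'r] := reachable_trans (linked _ _ (valP p') cC) cr.
exists ((u ++ y ++ v) ++ z).
exact: synchronizes_to_cat (synchronizes_to_initial initC detG us sp pp' vNC) p'r.
Qed.
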